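(* Let $H,K$ be complex Hilbert spaces, let $A\in CR(K,H)\cap BCR(K,H)$ and $B\in CR(H,K)\cap BCR(H,K)$, and let $$T=\begin{bmatrix} 0 & A \\ B & 0 \end{bmatrix}=\bigl\{\{(x,y),(y_a,x_b)\}:\{x,x_b\}\in B,\ \{y,y_a\}\in A\bigr\},$$ a linear relation in $H\times K$ with domain $H\times K$. Assume that $AB$ and $BA$ are closed linear relations in $H$ and $K$, respectively. Then: (1) $\sigma_{e_4}(T)=\{\lambda\in\mathbb{C}:\lambda^2\in\sigma_{e_4}(AB)\cup\sigma_{e_4}(BA)\}$. (2) $\sigma_{e_3}(T)=\bigl\{\lambda\in\mathbb{C}:\lambda^2\in\sigma_{e_3}(AB)\cup\sigma_{e_3}(BA)\cup[\sigma_{e_1}(AB)\cap\sigma_{e_2}(BA)]\cup[\sigma_{e_2}(AB)\cap\sigma_{e_1}(BA)]\bigr\}$.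
   Context: A linear relation from a Hilbert space $H$ into a Hilbert space $K$ is a linear subspace $T$ of $H\times K$, whose elements are written $\{x,y\}$; $CR(H,K)$ is the set of those that are closed subspaces. $D(T)=\{x:\{x,y\}\in T\text{ for some }y\}$, $R(T)=\{y:\{x,y\}\in T\text{ for some }x\}$, $N(T)=\{x:\{x,0\}\in T\}$, $M(T)=\{y:\{0,y\}\in T\}$. $Q_T$ is the quotient map $K\to K/\overline{M(T)}$; $T$ is continuous if the operator $Q_TT$ is bounded, and $BCR(H,K)$ is the set of continuous linear relations with $D(T)=H$. Products: $TS=\{\{x,y\}:\{x,z\}\in S,\ \{z,y\}\in T\text{ for some }z\}$. For $\lambda\in\mathbb{C}$, $T-\lambda I=\{\{x,y-\lambda x\}:\{x,y\}\in T\}$. $\phi_+(H,K)$ is the set of closed linear relations with closed range and $\dim N(T)<\infty$; $\phi_-(H,K)$ is the set of closed linear relations whose range is a closed subspace of $K$ of finite codimension. For a closed linear relation $T$ in a Hilbert space $X$, writing $\phi_\pm=\phi_\pm(X,X)$: $\sigma_{e_1}(T)=\{\lambda\in\mathbb{C}:T-\lambda I\notin\phi_+\}$, $\sigma_{e_2}(T)=\{\lambda\in\mathbb{C}:T-\lambda I\notin\phi_-\}$, $\sigma_{e_3}(T)=\{\lambda\in\mathbb{C}:T-\lambda I\notin\phi_+\cup\phi_-\}$, $\sigma_{e_4}(T)=\{\lambda\in\mathbb{C}:T-\lambda I\notin\phi_+\cap\phi_-\}$. $H\times K$ is the Hilbert space direct sum. *)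

(* Defs.v *)
From HB Require Import structures.
From mathcomp Require Import all_boot all_order all_algebra.
From mathcomp Require Import all_classical all_reals all_analysis.
From mathcomp Require Import sesquilinear complex ring.

Set Implicit Arguments.
Unset Strict Implicit.
Unset Printing Implicit Defensive.

Import Order.TTheory GRing.Theory Num.Def Num.Theory.
Import numFieldNormedType.Exports.

Local Open Scope classical_set_scope.
Local Open Scope ring_scope.

(* [inner] is linear in its first argument and conjugate-linear in its second
   one; norms of vectors take their (real) values in [R[i]]. *)
HB.mixin Record CompleteNormedModule_isHilbert (R : realType) V
    & CompleteNormedModule R[i] V := {
  inner : {dot V for (@conjC R[i])};
  innerE : forall x : V, inner x x = `|x| ^+ 2
}.

#[short(type="hilbertType")]
HB.structure Definition Hilbert (R : realType) :=
  {V of CompleteNormedModule R[i] V & CompleteNormedModule_isHilbert R V}.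

(* The library's norm on [H * K] is the maximum of the norms of the components,
   so the Hilbert space direct sum is an alias of that type with its own
   norm. *)
Definition hsum (R : realType) (H K : hilbertType R) : Type := (H * K)%type.

Lemma sqrtC_minkowski (C : numClosedFieldType) (a b c d : C) :
  0 <= a -> 0 <= b -> 0 <= c -> 0 <= d ->
  sqrtC ((a + c) ^+ 2 + (b + d) ^+ 2) <=
  sqrtC (a ^+ 2 + b ^+ 2) + sqrtC (c ^+ 2 + d ^+ 2).
Proof.
move=> a0 b0 c0 d0.
have ab0 : 0 <= a ^+ 2 + b ^+ 2 by rewrite addr_ge0 ?exprn_ge0.
have cd0 : 0 <= c ^+ 2 + d ^+ 2 by rewrite addr_ge0 ?exprn_ge0.
have s0 : 0 <= sqrtC (a ^+ 2 + b ^+ 2) by rewrite sqrtC_ge0.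
have t0 : 0 <= sqrtC (c ^+ 2 + d ^+ 2) by rewrite sqrtC_ge0.
have ac0 : 0 <= (a + c) ^+ 2 + (b + d) ^+ 2.
  by rewrite addr_ge0 ?exprn_ge0 ?addr_ge0.
rewrite -(@ler_pXn2r _ 2) ?nnegrE ?sqrtC_ge0 ?ac0 ?addr_ge0 //.
rewrite sqrtCK [leRHS]sqrrD !sqrtCK.
set p := sqrtC _ * _.
have p0 : 0 <= p by rewrite mulr_ge0.
have acbd : a * c + b * d <= p.
  rewrite -(@ler_pXn2r _ 2) ?nnegrE ?addr_ge0 ?mulr_ge0 //.
  rewrite exprMn !sqrtCK -subr_ge0.
  suff -> : (a ^+ 2 + b ^+ 2) * (c ^+ 2 + d ^+ 2) - (a * c + b * d) ^+ 2
    = (a * d - b * c) ^+ 2.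
    by rewrite -realEsqr realB // ger0_real ?mulr_ge0.
  by ring.
have -> : (a + c) ^+ 2 + (b + d) ^+ 2 =
  (a ^+ 2 + b ^+ 2) + (a * c + b * d) *+ 2 + (c ^+ 2 + d ^+ 2) by ring.
by rewrite lerD2r lerD2l lerMn2r.
Qed.

Section HilbertSum.
Context (R : realType) (H K : hilbertType R).
Local Notation HK := (hsum H K).
Local Notation C := R[i].

HB.instance Definition _ := GRing.Lmodule.copy HK (H * K)%type.

Definition hsum_norm (u : HK) : C := sqrtC (`|u.1| ^+ 2 + `|u.2| ^+ 2).

Let hsum_normD u v : hsum_norm (u + v) <= hsum_norm u + hsum_norm v.
Proof.
apply: (@le_trans _ _
  (sqrtC ((`|u.1| + `|v.1|) ^+ 2 + (`|u.2| + `|v.2|) ^+ 2))).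
  rewrite ler_sqrtC ?nnegrE ?addr_ge0 ?exprn_ge0 ?addr_ge0 //.
  by rewrite lerD // lerXn2r ?nnegrE ?addr_ge0 ?ler_normD.
by apply: sqrtC_minkowski.
Qed.

Let hsum_normZ (l : C) u : hsum_norm (l *: u) = `|l| * hsum_norm u.
Proof.
rewrite /hsum_norm !normrZ !exprMn -mulrDr sqrtCM ?nnegrE ?addr_ge0 ?exprn_ge0 //.
by rewrite sqrCK.
Qed.

Let hsum_norm_eq0 u : hsum_norm u = 0 -> u = 0.
Proof.
move=> /eqP; rewrite sqrtC_eq0 paddr_eq0 ?exprn_ge0 // !sqrf_eq0 !normr_eq0.
by case: u => x y /= /andP[/eqP -> /eqP ->].
Qed.

HB.instance Definition _ := Lmodule_isNormed.Build C HK
  hsum_normD hsum_normZ hsum_norm_eq0.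

Lemma hsum_normE (u : HK) : `|u| = sqrtC (`|u.1| ^+ 2 + `|u.2| ^+ 2).
Proof. by []. Qed.

Lemma hsum_norm_fst (u : HK) : `|u.1| <= `|u|.
Proof.
rewrite hsum_normE -[leLHS]sqrCK // ler_sqrtC ?nnegrE ?addr_ge0 ?exprn_ge0 //.
by rewrite lerDl exprn_ge0.
Qed.

Lemma hsum_norm_snd (u : HK) : `|u.2| <= `|u|.
Proof.
rewrite hsum_normE -[leLHS]sqrCK // ler_sqrtC ?nnegrE ?addr_ge0 ?exprn_ge0 //.
by rewrite lerDr exprn_ge0.
Qed.

Lemma hsum_norm_le (u : HK) : `|u| <= `|u.1| + `|u.2|.
Proof.
rewrite hsum_normE -[leRHS]sqrCK ?addr_ge0 //.
rewrite ler_sqrtC ?nnegrE ?addr_ge0 ?exprn_ge0 ?addr_ge0 //.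
by rewrite sqrrD lerD2r lerDl mulrn_wge0 ?mulr_ge0.
Qed.

Let hsum_complete (F : set_system HK) : ProperFilter F -> cauchy F -> cvg F.
Proof.
move=> FF /cauchy_ballP Fc.
have cB (V : hilbertType R) (f : HK -> V) :
    (forall u v, `|f u - f v| <= `|u - v|) -> cauchy (f @ F).
  move=> fN; apply/(cauchy_ballP (f @ F)) => e e0.
  rewrite near_map2; apply: filterS (Fc e e0) => -[u v] /=.
  by rewrite -!ball_normE /=; exact: le_lt_trans.
have c1 := cB H _ (fun u v => hsum_norm_fst (u - v)).
have c2 := cB K _ (fun u v => hsum_norm_snd (u - v)).
have [x Fx] := (@cvg_ex H _).1 (cauchy_cvg _ c1).
have [y Fy] := (@cvg_ex K _).1 (cauchy_cvg _ c2).
apply/cvg_ex; exists ((x, y) : HK).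
apply/(@cvgrPdist_lt C HK _ F FF id) => e e0.
have e20 : 0 < e / 2 by rewrite divr_gt0.
have {}Fx := (@cvgrPdist_lt C H _ F FF (fun u : HK => u.1 : H) x).1 Fx _ e20.
have {}Fy := (@cvgrPdist_lt C K _ F FF (fun u : HK => u.2 : K) y).1 Fy _ e20.
near=> u.
rewrite (le_lt_trans (hsum_norm_le _)) // [e]splitr ltrD //=.
  by near: u; exact: Fx.
by near: u; exact: Fy.
Unshelve. all: by end_near. Qed.

HB.instance Definition _ := Uniform_isComplete.Build HK hsum_complete.

Definition hsum_inner (u v : HK) : C := inner u.1 v.1 + inner u.2 v.2.

Let hsum_inner_bilin :
  bilinear_for *%R (conjC \; *%R : GRing.Scale.law _ _) hsum_inner.
Proof.
split=> u' a u v; rewrite /hsum_inner /=.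
  by rewrite !linearDl !linearZl_LR /= mulrDr addrACA.
by rewrite !linearDr !linearZr_LR /= addrACA.
Qed.

HB.instance Definition _ := bilinear_isBilinear.Build C HK HK C
  *%R (conjC \; *%R) hsum_inner hsum_inner_bilin.

Let hsum_inner_herm (u v : HK) :
  hsum_inner u v = (-1) ^+ false * conjC (hsum_inner v u).
Proof.
have iC (V : hilbertType R) (x y : V) : inner x y = conjC (inner y x).
  by rewrite hermC expr0 mul1r.
by rewrite /hsum_inner expr0 mul1r rmorphD /= -!iC.
Qed.

HB.instance Definition _ := isHermitianSesquilinear.Build C HK false conjC
  hsum_inner hsum_inner_herm.

Let hsum_innerE (u : HK) : hsum_inner u u = `|u| ^+ 2.
Proof. by rewrite hsum_normE sqrtCK /hsum_inner !innerE. Qed.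

Let hsum_inner_gt0 (u : HK) : u != 0 -> 0 < hsum_inner u u.
Proof. by move=> u0; rewrite hsum_innerE exprn_gt0 // normr_gt0. Qed.

HB.instance Definition _ := isDotProduct.Build C HK hsum_inner hsum_inner_gt0.

HB.instance Definition _ :=
  CompleteNormedModule_isHilbert.Build R HK hsum_innerE.
End HilbertSum.

Section LinearRelations.
Context (R : realType).
Local Notation C := R[i].
Implicit Types H K L X : hilbertType R.

Definition is_subspace H (S : set H) : Prop :=
  S 0 /\ forall (a : C) (u v : H), S u -> S v -> S (a *: u + v).

Definition linear_relation H K (T : set (hsum H K)) : Prop := is_subspace T.

Definition CR H K (T : set (hsum H K)) : Prop :=
  linear_relation T /\ closed T.

Definition rel_dom H K (T : set (hsum H K)) : set H :=
  [set x | exists y, T (x, y)].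
Definition rel_ran H K (T : set (hsum H K)) : set K :=
  [set y | exists x, T (x, y)].
Definition rel_ker H K (T : set (hsum H K)) : set H := [set x | T (x, 0)].
Definition rel_mul H K (T : set (hsum H K)) : set K := [set y | T (0, y)].

(* The norm of the coset of [y] in the quotient of [K] by [M]. *)
Definition quot_norm K (M : set K) (y : K) : R :=
  inf [set complex.Re `|y - m| | m in M].

(* [Q_T T] is bounded, where [Q_T : K -> K / closure (M T)]. *)
Definition rel_continuous H K (T : set (hsum H K)) : Prop :=
  exists c : R, forall (x : H) (y : K), T (x, y) ->
    quot_norm (closure (rel_mul T)) y <= c * complex.Re `|x|.

Definition BCR H K (T : set (hsum H K)) : Prop :=
  [/\ linear_relation T, rel_continuous T & rel_dom T = setT].

Definition rel_comp H K L (T : set (hsum K L)) (S : set (hsum H K)) :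
    set (hsum H L) :=
  [set p | exists2 z, S (p.1, z) & T (z, p.2)].

Definition rel_shift X (T : set (hsum X X)) (l : C) : set (hsum X X) :=
  [set p | exists2 y, T (p.1, y) & p.2 = y - l *: p.1].

Definition lin_span X n (e : 'I_n -> X) : set X :=
  [set x | exists c : 'I_n -> C, x = \sum_(i < n) c i *: e i].

Definition finite_dim X (S : set X) : Prop :=
  exists (n : nat) (e : 'I_n -> X), S = lin_span e.

(* The quotient of [X] by the subspace [S] is spanned by finitely many
   cosets. *)
Definition finite_codim X (S : set X) : Prop :=
  exists (n : nat) (e : 'I_n -> X),
    forall x, exists2 s, lin_span e s & S (x - s).

Definition phi_plus H K (T : set (hsum H K)) : Prop :=
  [/\ CR T, closed (rel_ran T) & finite_dim (rel_ker T)].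

Definition phi_minus H K (T : set (hsum H K)) : Prop :=
  [/\ CR T, closed (rel_ran T) & finite_codim (rel_ran T)].

Definition sigma_e1 X (T : set (hsum X X)) : set C :=
  [set l | ~ phi_plus (rel_shift T l)].
Definition sigma_e2 X (T : set (hsum X X)) : set C :=
  [set l | ~ phi_minus (rel_shift T l)].
Definition sigma_e3 X (T : set (hsum X X)) : set C :=
  [set l | ~ (phi_plus (rel_shift T l) \/ phi_minus (rel_shift T l))].
Definition sigma_e4 X (T : set (hsum X X)) : set C :=
  [set l | ~ (phi_plus (rel_shift T l) /\ phi_minus (rel_shift T l))].

Definition antidiag H K (A : set (hsum K H)) (B : set (hsum H K)) :
    set (hsum (hsum H K) (hsum H K)) :=
  [set p : hsum (hsum H K) (hsum H K) | B (p.1.1, p.2.2) /\ A (p.1.2, p.2.1)].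

End LinearRelations.

(* Main.v *)
Require Import Defs.
From mathcomp Require Import all_boot all_order all_algebra.
From mathcomp Require Import all_classical all_reals all_analysis.
From mathcomp Require Import sesquilinear complex ring lra.

Import Order.TTheory GRing.Theory Num.Theory.
Import numFieldNormedType.Exports.
Local Open Scope classical_set_scope.
Local Open Scope ring_scope.

Set Implicit Arguments.
Unset Strict Implicit.
Unset Printing Implicit Defensive.

(** Why the theorem holds.  Write [S = T - l] and [S' = T + l].  As for
operators, [S S' = T^2 - l^2], and [T^2] is the direct sum of [AB] and [BA];
hence [S S' = S' S] is the direct sum of [AB - l^2] and [BA - l^2]
([antidiag_factor]).  Moreover the isometry [(x, y) |-> (x, -y)] turns [S] into
[-S'], so that [S] and [S'] are semi-Fredholm of the same kind
([antidiag_conj_phi]).  It follows, for each of the two classes, that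
- [T - l] is in [phi_+] iff both [AB - l^2] and [BA - l^2] are
  ([antidiag_phi_plus]);
- [T - l] is in [phi_-] iff both [AB - l^2] and [BA - l^2] are
  ([antidiag_phi_minus]).
The two formulas for the spectra are then propositional consequences: for
[sigma_e3] one distributes the negation over
[(P in phi_+ and Q in phi_+) or (P in phi_- and Q in phi_-)], where
[P = AB - l^2] and [Q = BA - l^2].

Passing between a product and its factors is the analytic part.  Products of
two [phi_+] (two [phi_-]) relations with closed product are again in the class
([phi_plus_comp], [phi_minus_comp]); a left factor of a [phi_-] product is in
[phi_-] ([phi_minus_compl]); and a right factor of a [phi_+] product is in
[phi_+] when the left factor is everywhere defined with a finite-dimensional
kernel ([phi_plus_compr]).  The dimension counts all come from one fact: a
linear relation maps [N] plus the span of finitely many vectors onto the image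
of [N] plus the span of finitely many vectors ([rel_img_adjoin]).  The closed
ranges come from two facts: the open mapping theorem for closed relations with
closed range ([open_mapping]), and its consequence, due to Kato, that the range
of a closed relation is closed as soon as it becomes so after adding finitely
many vectors ([adjoin_ran_closed]). *)

(** * Real-valued norms, closedness and completeness *)

Lemma gt0_complexP (R : realType) (e : R[i]) :
  0 < e -> exists2 d : R, 0 < d & e = d%:C%C.
Proof.
move=> e0; have eR : e = (complex.Re e)%:C%C by rewrite RRe_real ?gtr0_real.
by exists (complex.Re e) => //; rewrite -ltcR -eR.
Qed.

Section RealNorm.
Context (R : realType) (V : hilbertType R).
Local Notation C := R[i].
Implicit Types (x y : V) (S : set V).

(** The norm takes its values in [R[i]], whose order is partial; its real part
lives in an ordered field, where estimates are linear arithmetic. *)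
Definition rnorm x : R := complex.Re `|x|.

Lemma rnormE x : `|x| = (rnorm x)%:C%C.
Proof. by rewrite /rnorm RRe_real // normr_real. Qed.

Lemma rnorm_ge0 x : 0 <= rnorm x.
Proof. by rewrite -ler0c -rnormE. Qed.

Lemma rnorm0 : rnorm 0 = 0.
Proof. by rewrite /rnorm normr0. Qed.

Lemma rnorm_eq0 x : rnorm x = 0 -> x = 0.
Proof. by move=> x0; apply/normr0_eq0; rewrite rnormE x0. Qed.

Lemma rnormN x : rnorm (- x) = rnorm x.
Proof. by rewrite /rnorm normrN. Qed.

Lemma rnormB x y : rnorm (x - y) = rnorm (y - x).
Proof. by rewrite -rnormN opprB. Qed.

Lemma rnormD x y : rnorm (x + y) <= rnorm x + rnorm y.
Proof. by rewrite -lecR rmorphD /= -!rnormE ler_normD. Qed.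

Lemma rnorm_triangle z x y : rnorm (x - y) <= rnorm (x - z) + rnorm (z - y).
Proof. by rewrite -[x - y](subrKA z) rnormD. Qed.

Lemma rnormZ (a : C) x : rnorm (a *: x) = complex.Re `|a| * rnorm x.
Proof.
apply: (@complexI R); rewrite rmorphM /= -!rnormE normrZ.
by congr (_ * _); rewrite (RRe_real (normr_real a)).
Qed.

Lemma rnormZr (t : R) x : 0 <= t -> rnorm (t%:C%C *: x) = t * rnorm x.
Proof. by move=> t0; rewrite rnormZ ger0_norm // ler0c. Qed.

Lemma small_rnorm_eq0 x : (forall e, 0 < e -> rnorm x <= e) -> x = 0.
Proof.
move=> xe; apply: rnorm_eq0; apply/eqP; rewrite eq_le rnorm_ge0 andbT.
by apply/ler_addgt0Pr => e e0; rewrite add0r xe.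
Qed.

Lemma closedP S :
  closed S <->
  forall x, (forall e : R, 0 < e -> exists2 s, S s & rnorm (x - s) < e) -> S x.
Proof.
split=> [Sc x xS|Sx x xS].
  apply: Sc => A /nbhs_ballP[_ /gt0_complexP[e e0 ->] eA].
  have [s Ss xs] := xS _ e0; exists s; split => //.
  by apply: eA; rewrite -ball_normE /= rnormE ltcR.
apply: Sx => e e0.
have /xS[s [Ss]] : nbhs x (ball x (e%:C%C : C)) by apply: nbhsx_ballx; rewrite ltcR.
by rewrite -ball_normE /= rnormE ltcR; exists s.
Qed.

(** [r k] is at most [r 0 / (k + 1)], since [k + 2 <= 2 (k + 1)]. *)
Lemma half_decay (r : nat -> R) :
  (forall k, 0 < r k) -> (forall k, 2 * r k.+1 <= r k) ->
  forall e, 0 < e -> exists N, forall k, (N <= k)%N -> r k < e.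
Proof.
move=> r0 r2 e e0.
have rk k : r k * k.+1%:R <= r 0%N.
  elim: k => [|k IH]; first by rewrite mulr1.
  apply: le_trans IH; apply: le_trans (ler_wpM2r (ler0n _ _) (r2 k)).
  rewrite [2 * _]mulrC -mulrA ler_pM2l // -natrM ler_nat.
  by rewrite mul2n -addnn addSn ltnS addnS ltnS leq_addl.
exists (Num.truncn (r 0%N / e)) => k Nk.
have : r 0%N / e < k.+1%:R.
  by apply: lt_le_trans (truncnS_gt _) _; rewrite ler_nat ltnS.
rewrite ltr_pdivrMr // => h.
have := le_lt_trans (rk k) h.
by rewrite mulrC ltr_pM2l.
Qed.

(** The only form of completeness used below: the tails of the sum of the
steps are dominated by a geometric series of ratio [1/2], which gives the
explicit distance to the limit. *)
Lemma halving_cvg (u : nat -> V) (r : nat -> R) :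
  (forall k, 0 < r k) -> (forall k, 2 * r k.+1 <= r k) ->
  (forall k, rnorm (u k - u k.+1) <= r k) ->
  exists l, forall k, rnorm (u k - l) <= 2 * r k.
Proof.
move=> r0 r2 ur.
have uD j : forall k, rnorm (u k - u (k + j)%N) <= 2 * r k.
  elim: j => [|j IH] k; first by rewrite addn0 subrr rnorm0 mulr_ge0 // ltW.
  rewrite addnS -addSn.
  have := rnorm_triangle (u k.+1) (u k) (u (k.+1 + j)%N).
  have := IH k.+1; have := ur k; have := r2 k; lra.
have ule k m : (k <= m)%N -> rnorm (u k - u m) <= 2 * r k.
  by move=> /subnKC <-; exact: uD.
have /cauchy_cvg uc : cauchy (u @ \oo).
  apply/cauchy_ballP => _ /gt0_complexP[e e0 ->].
  have [N rN] := half_decay r0 r2 (divr_gt0 e0 (ltr0n _ 4)).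
  rewrite near_map2; exists ([set k | (N <= k)%N], [set k | (N <= k)%N]).
    by split; exists N.
  move=> [k m] [/= Nk Nm]; rewrite -ball_normE /= rnormE ltcR.
  have := rnorm_triangle (u N) (u k) (u m).
  have := ule _ _ Nk; have := ule _ _ Nm; have := rN N (leqnn _).
  rewrite (rnormB (u k) (u N)); lra.
have [l ul] := (@cvg_ex V _).1 uc; exists l => k.
apply/ler_addgt0Pr => e e0.
have e0c : 0 < (e%:C%C : C) by rewrite ltcR.
have [N _ uN] := (@cvgrPdist_lt C V _ (nbhs \oo) _ u l).1 ul _ e0c.
have := uN (maxn N k) (leq_maxl _ _); rewrite /= rnormE ltcR.
have := ule _ _ (leq_maxr N k).
have := rnorm_triangle (u (maxn N k)) (u k) l.
rewrite [rnorm (l - _)]rnormB; lra.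
Qed.

End RealNorm.

(** * Subspaces and linear relations *)

Section Subspaces.
Context (R : realType).
Local Notation C := R[i].
Implicit Types X Y : hilbertType R.

Section OneSpace.
Context X (S : set X) (subS : is_subspace S).

Lemma subspace0 : S 0. Proof. by case: subS. Qed.

Lemma subspaceD x y : S x -> S y -> S (x + y).
Proof. by move=> Sx Sy; rewrite -[x]scale1r; apply: (subS.2). Qed.

Lemma subspaceZ (a : C) x : S x -> S (a *: x).
Proof. by move=> Sx; rewrite -[_ *: _]addr0; apply: (subS.2) subspace0. Qed.

Lemma subspaceB x y : S x -> S y -> S (x - y).
Proof. by move=> Sx Sy; rewrite -scaleN1r addrC; apply: (subS.2). Qed.

End OneSpace.

Section HsumNorm.
Context X Y.
Implicit Types (x : X) (y : Y) (p : hsum X Y).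

Lemma rnorm_fst p : rnorm (p.1 : X) <= rnorm p.
Proof. by rewrite -lecR -!rnormE hsum_norm_fst. Qed.

Lemma rnorm_snd p : rnorm (p.2 : Y) <= rnorm p.
Proof. by rewrite -lecR -!rnormE hsum_norm_snd. Qed.

Lemma rnorm_pair p : rnorm p <= rnorm (p.1 : X) + rnorm (p.2 : Y).
Proof. by rewrite -lecR rmorphD /= -!rnormE hsum_norm_le. Qed.

End HsumNorm.

Section Relations.
Context X Y (S : set (hsum X Y)).
Hypothesis subS : linear_relation S.

Lemma relD x y x' y' : S (x, y) -> S (x', y') -> S (x + x', y + y').
Proof. by move=> S1 S2; exact: (subspaceD subS S1 S2). Qed.

Lemma relB x y x' y' : S (x, y) -> S (x', y') -> S (x - x', y - y').
Proof. by move=> S1 S2; exact: (subspaceB subS S1 S2). Qed.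

Lemma relZ a x y : S (x, y) -> S (a *: x, a *: y).
Proof. by move=> S1; exact: (subspaceZ subS a S1). Qed.

Lemma rel_ran_subspace : is_subspace (rel_ran S).
Proof.
split=> [|a y y' [x Sxy] [x' Sxy']]; first by exists 0; exact: (subspace0 subS).
by exists (a *: x + x'); exact: (relD (relZ a Sxy) Sxy').
Qed.

Lemma rel_ker_subspace : is_subspace (rel_ker S).
Proof.
split=> [|a x x' Sx Sx']; first exact: (subspace0 subS).
by have := relD (relZ a Sx) Sx'; rewrite scaler0 addr0.
Qed.

End Relations.

Lemma closed_relP X Y (S : set (hsum X Y)) :
  closed S <-> forall x y, (forall e : R, 0 < e ->
    exists x' y', [/\ S (x', y'), rnorm (x - x') < e & rnorm (y - y') < e]) ->
    S (x, y).
Proof.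
split=> [/closedP Sc x y xyS|Sc].
  apply: Sc => e e0; have [x' [y' [Sxy xe ye]]] := xyS _ (divr_gt0 e0 (ltr0n _ 2)).
  exists (x', y') => //; apply: le_lt_trans (rnorm_pair _) _ => /=; lra.
apply/closedP => -[x y] xyS; apply: Sc => e /xyS [[x' y'] Sxy xye].
by exists x', y'; split=> //; apply: le_lt_trans xye;
  [exact: (rnorm_fst ((x, y) - (x', y') : hsum X Y))|
   exact: (rnorm_snd ((x, y) - (x', y') : hsum X Y))].
Qed.

Definition rel_inv X Y (S : set (hsum X Y)) : set (hsum Y X) :=
  [set p | S (p.2, p.1)].

Lemma rel_inv_subspace X Y (S : set (hsum X Y)) :
  linear_relation S -> linear_relation (rel_inv S).
Proof.
move=> subS; split=> [|a [x y] [x' y'] Sxy Sxy']; first exact: (subspace0 subS).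
exact: (relD subS (relZ subS a Sxy) Sxy').
Qed.

Lemma rel_inv_CR X Y (S : set (hsum X Y)) : CR S -> CR (rel_inv S).
Proof.
move=> [subS Sc]; split; first exact: rel_inv_subspace.
apply/closed_relP => y x yxS; apply: ((closed_relP _).1 Sc) => e /yxS.
by move=> [y' [x' [Sxy ye xe]]]; exists x', y'; split.
Qed.

(** * The open mapping theorem *)

Section OpenMapping.
Context X Y (S : set (hsum X Y)) (CRS : CR S) (ranS : closed (rel_ran S)).

Let subS : linear_relation S := CRS.1.

(** Baire's argument is run inside the closed set [rel_ran S], covered by the
images [reach n] of the balls of radius [n]. *)
Let reach (n : R) : set Y := [set y | exists2 x, S (x, y) & rnorm x <= n].

Let dense_ball (n : R) (w : Y) (r : R) := forall v, rel_ran S v ->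
  rnorm (v - w) < r -> forall e, 0 < e -> exists2 v', reach n v' & rnorm (v - v') < e.

(** If no [reach n] were dense in a ball of [rel_ran S], one could choose nested
balls, the (n+1)-st one missing [reach n]; their common point would lie in the
closed range but in no [reach n]. *)
Let exists_dense_ball :
  exists (n : R) w (r : R), [/\ rel_ran S w, 0 < r & dense_ball n w r].
Proof.
apply: contrapT => nodense.
have step (n : nat) (p : Y * R) : exists q : Y * R, rel_ran S p.1 -> 0 < p.2 ->
    [/\ rel_ran S q.1, 0 < q.2, 2 * q.2 <= p.2, rnorm (p.1 - q.1) <= p.2 &
        forall v, reach n%:R v -> 2 * q.2 < rnorm (q.1 - v)].
  have [Sw|nS] := pselect (rel_ran S p.1); last by exists p.
  have [r0|r0] := ltP 0 p.2; last by exists p.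
  have : ~ dense_ball n%:R p.1 p.2.
    by move=> d; apply: nodense; exists n%:R, p.1, p.2.
  move=> /existsNP[v] /not_implyP[Sv] /not_implyP[vw] /existsNP[e].
  (* A radius [q.2 <= e / 3] keeps every point within [2 * q.2] of [v], hence
     the limit of the centers, away from [reach n]. *)
  move=> /not_implyP[e0 far]; exists (v, Num.min (e / 3) (p.2 / 2)) => _ _ /=.
  split=> //.
  - by rewrite lt_min !divr_gt0.
  - by have : Num.min (e / 3) (p.2 / 2) <= p.2 / 2; [rewrite ge_min lexx orbT|lra].
  - by rewrite rnormB ltW.
  - move=> v' v'n; have : e <= rnorm (v - v').
      by rewrite leNgt; apply/negP => ?; apply: far; exists v'.
    have : Num.min (e / 3) (p.2 / 2) <= e / 3 by rewrite ge_min lexx.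
    lra.
have [f fP] := choice (fun np : nat * (Y * R) => step np.1 np.2).
pose s := fix s k := if k is j.+1 then f (j, s j) else (0, 1) : Y * R.
have s0 k : rel_ran S (s k).1 /\ 0 < (s k).2.
  elim: k => [|k [Sk rk]]; first by split=> //; exact: (subspace0 (rel_ran_subspace subS)).
  by have [] := fP (k, s k) Sk rk.
have sP k := fP (k, s k) (s0 k).1 (s0 k).2.
have rs0 k : 0 < (s k).2 by case: (s0 k).
have rs2 k : 2 * (s k.+1).2 <= (s k).2 by case: (sP k).
have [l lP] : exists l, forall k, rnorm ((s k).1 - l) <= 2 * (s k).2.
  by apply: halving_cvg rs0 rs2 _ => k; case: (sP k).
have [x Sxl] : rel_ran S l.
  apply: ((closedP _).1 ranS) => e e0.
  have [N /(_ _ (leqnn N)) rN] := half_decay rs0 rs2 (divr_gt0 e0 (ltr0n _ 2)).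
  exists (s N).1; first by case: (s0 N).
  by rewrite rnormB; have := lP N; move: rN => /=; lra.
pose n := (Num.truncn (rnorm x)).+1.
have xn : reach n%:R l by exists x => //; exact/ltW/truncnS_gt.
have [_ _ _ _ /(_ _ xn)] := sP n.
by have := lP n.+1; rewrite /= leNgt => /negP.
Qed.

(** Differences of two points of the ball give density near 0, and scaling
carries it to every right-hand side. *)
Let approx : exists2 c : R, 0 <= c & forall w, rel_ran S w ->
  exists2 p : hsum X Y, S p &
    rnorm (p.1 : X) <= c * rnorm w /\ rnorm (w - p.2 : Y) <= rnorm w / 2.
Proof.
have [n [w0 [r [Sw0 r0 dense]]]] := exists_dense_ball.
have n0 : 0 <= n.
  have [||w [x _ xn] _] := dense w0 Sw0 _ 1; rewrite ?subrr ?rnorm0 //.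
  exact: le_trans (rnorm_ge0 _) xn.
exists (4 * n / r) => [|w Sw]; first by rewrite divr_ge0 ?mulr_ge0 // ltW.
have [->|w_neq0] := eqVneq w 0.
  exists 0; first exact: subspace0.
  by rewrite !rnorm0 mulr0 subr0 mul0r rnorm0.
have w_gt0 : 0 < rnorm w.
  rewrite lt_neqAle rnorm_ge0 andbT eq_sym.
  by apply: contra w_neq0 => /eqP /rnorm_eq0 ->.
(* [t w] has norm [r / 2], so [w0 + t w] stays in the ball; the two errors of
   size [r / 8] add up to half of [t rnorm w]. *)
pose t := r / (2 * rnorm w).
have t0 : 0 < t by rewrite divr_gt0 // mulr_gt0.
have r8 : 0 < r / 8 by rewrite divr_gt0.
have Ran := rel_ran_subspace subS.
have [|v1 [x1 S1 x1n] v1e] := dense w0 Sw0 _ (r / 8) r8.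
  by rewrite subrr rnorm0.
have [||v2 [x2 S2 x2n] v2e] := dense (w0 + t%:C%C *: w) _ _ (r / 8) r8.
- by apply: subspaceD => //; exact: subspaceZ.
- rewrite addrC addKr rnormZr ?ltW // /t; set a := rnorm w.
  have -> : r / (2 * a) * a = r / 2 by field; rewrite gt_eqF.
  lra.
exists (((t^-1)%:C%C *: (x2 - x1), (t^-1)%:C%C *: (v2 - v1)) : hsum X Y).
  by apply: relZ => //; exact: relB.
have tV0 : 0 <= t^-1 by rewrite invr_ge0 ltW.
split=> /=.
  rewrite rnormZr // /t invf_div.
  have x21 : rnorm (x2 - x1) <= 2 * n.
    have := rnormD x2 (- x1); rewrite rnormN; lra.
  apply: le_trans (ler_wpM2l _ x21) _.
    by rewrite divr_ge0 ?mulr_ge0 ?rnorm_ge0 // ltW.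
  by rewrite le_eqVlt; apply/orP; left; apply/eqP; field; rewrite gt_eqF.
have -> : w - (t^-1)%:C%C *: (v2 - v1) =
    (t^-1)%:C%C *: ((w0 + t%:C%C *: w - v2) - (w0 - v1)).
  have tt : (t^-1)%:C%C * t%:C%C = 1 by rewrite -rmorphM /= mulVf ?rmorph1 ?gt_eqF.
  have -> : w0 + t%:C%C *: w - v2 - (w0 - v1) = t%:C%C *: w - (v2 - v1).
    by rewrite [w0 + _]addrC -!addrA; congr (_ + _); rewrite addrA !opprB addrC subrKA.
  by rewrite [RHS]scalerBr scalerA tt scale1r.
rewrite rnormZr //.
have v21 : rnorm (w0 + t%:C%C *: w - v2 - (w0 - v1)) <= r / 4.
  by have := rnormD (w0 + t%:C%C *: w - v2) (- (w0 - v1)); rewrite rnormN; lra.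
apply: le_trans (ler_wpM2l tV0 v21) _.
by rewrite /t invf_div le_eqVlt; apply/orP; left; apply/eqP; field; rewrite gt_eqF.
Qed.

(** [approx] solves the equation up to half of its right-hand side; solving
again for the remainder gives a series of solutions that converges
geometrically, and its sum is a solution because [S] is closed. *)
Lemma open_mapping : exists c : R, forall y, rel_ran S y ->
  exists2 x, S (x, y) & rnorm x <= c * rnorm y.
Proof.
have [c c0 cP] := approx.
have {}cP w : exists p : hsum X Y, rel_ran S w -> [/\ S p,
    rnorm (p.1 : X) <= c * rnorm w & rnorm (w - p.2 : Y) <= rnorm w / 2].
  have [/cP[p Sp [p1 p2]]|nS] := pselect (rel_ran S w); first by exists p.
  by exists 0.
have [f fP] := choice cP.
exists (2 * (c + 1)) => w Sw.
have [w0|w_neq0] := eqVneq w 0.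
  exists 0; first by rewrite w0; exact: (subspace0 subS).
  by rewrite w0 !rnorm0 mulr0.
have w_gt0 : 0 < rnorm w.
  rewrite lt_neqAle rnorm_ge0 andbT eq_sym.
  by apply: contra w_neq0 => /eqP /rnorm_eq0 ->.
pose s := fix s k : hsum X Y :=
  if k is j.+1 then s j + f (w - (s j).2) else 0.
have sS k : S (s k) /\ rel_ran S (w - (s k).2).
  elim: k => [|k [Sk Rk]] /=.
    by rewrite subr0; split=> //; exact: (subspace0 subS).
  have [Sf _ _] := fP _ Rk.
  have Ss : S (s k + f (w - (s k).2)) by exact: subspaceD.
  split=> //; apply: subspaceB => //; first exact: rel_ran_subspace.
  by exists (s k + f (w - (s k).2)).1; rewrite -surjective_pairing.
have sP k := fP _ (sS k).2.
have decay k : rnorm (w - (s k).2) <= rnorm w / 2 ^+ k.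
  elim: k => [|k IH]; first by rewrite /= subr0 expr0 divr1.
  have [_ _] := sP k; rewrite /= opprD addrA exprSr invfM mulrA; lra.
pose r k : R := (c + 1) * rnorm w / 2 ^+ k.
have r0 k : 0 < r k by rewrite !mulr_gt0 ?invr_gt0 ?exprn_gt0 // ltr_wpDl.
have r2 k : 2 * r k.+1 <= r k.
  by rewrite /r exprS invfM mulrCA (mulrA 2) mulfV // mul1r.
have [k|x xP] := halving_cvg (u := fun k => (s k).1 : X) r0 r2.
  rewrite /= opprD addrA subrr add0r rnormN.
  have [_ + _] := sP k => /le_trans; apply.
  apply: le_trans (ler_wpM2l c0 (decay k)) _.
  rewrite mulrA ler_pM2r ?invr_gt0 ?exprn_gt0 //.
  by rewrite ler_pM2r // lerDl.
exists x; last first.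
  by have := xP 0%N; rewrite /r expr0 /= sub0r rnormN divr1 mulrA.
apply: ((closed_relP _).1 CRS.2) => e e0.
have [N /(_ _ (leqnn N)) rN] := half_decay r0 r2 (divr_gt0 e0 (ltr0n _ 2)).
exists (s N).1, (s N).2; split.
- by rewrite -surjective_pairing; case: (sS N).
- by rewrite rnormB; apply: le_lt_trans (xP N) _; lra.
- apply: le_lt_trans (decay N) _; apply: le_lt_trans (_ : r N < _); last by lra.
  rewrite /r ler_pM2r ?invr_gt0 ?exprn_gt0 // -[leLHS]mul1r.
  by rewrite ler_pM2r // lerDr.
Qed.

Lemma open_mapping_near (d : R) : 0 < d -> exists2 h : R, 0 < h &
  forall y, rel_ran S y -> rnorm y < h -> exists2 x, S (x, y) & rnorm x < d.
Proof.
move=> d0; have [c cP] := open_mapping.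
have c0 : 0 < `|c| + 1 by rewrite ltr_wpDl.
exists (d / (`|c| + 1)) => [|y Ry]; first by rewrite divr_gt0.
rewrite ltr_pdivlMr // => yd; have [x Sxy xy] := cP y Ry.
exists x => //; apply: le_lt_trans xy _; apply: le_lt_trans yd.
rewrite mulrC ler_wpM2l ?rnorm_ge0 // (le_trans (ler_norm c)) //.
by rewrite lerDl.
Qed.

End OpenMapping.
End Subspaces.

(** * Adjoining finitely many vectors to a subspace *)

Section Adjunction.
Context (R : realType).
Local Notation C := R[i].
Implicit Types X Y : hilbertType R.

(** Spans of finitely many vectors are built one vector at a time, on top of an
arbitrary base [M]; dimension and codimension arguments then become inductions
on the list of added vectors. *)
Definition adjoin1 X (e : X) (M : set X) : set X :=
  [set x | exists (c : C) (m : X), M m /\ x = c *: e + m].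

Definition adjoin X (M : set X) (s : seq X) : set X := foldr (@adjoin1 X) M s.

Section OneSpace.
Context X.
Implicit Types (M N : set X) (e : X) (s : seq X).

Lemma sub_adjoin1 e M : M `<=` adjoin1 e M.
Proof. by move=> m Mm; exists 0, m; rewrite scale0r add0r. Qed.

Lemma sub_adjoin s M : M `<=` adjoin M s.
Proof. by elim: s => //= e s IH m /IH; exact: sub_adjoin1. Qed.

Lemma adjoin_mono s M N : M `<=` N -> adjoin M s `<=` adjoin N s.
Proof.
move=> MN; elim: s => //= e s IH _ [c [m [/IH Nm ->]]]; by exists c, m.
Qed.

Lemma adjoin_cat M s t : adjoin M (s ++ t) = adjoin (adjoin M t) s.
Proof. exact: foldr_cat. Qed.

Lemma adjoin1_subspace e M : is_subspace M -> is_subspace (adjoin1 e M).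
Proof.
move=> subM; split=> [|a _ _ [c [m [Mm ->]]] [d [n [Mn ->]]]].
  by apply: sub_adjoin1; exact: (subspace0 subM).
exists (a * c + d), (a *: m + n); split; first exact: subM.2.
by rewrite scalerDr scalerDl scalerA addrACA.
Qed.

Lemma adjoin_subspace s M : is_subspace M -> is_subspace (adjoin M s).
Proof. by move=> subM; elim: s => //= e s; exact: adjoin1_subspace. Qed.

Lemma adjoin1_id e M : is_subspace M -> M e -> adjoin1 e M = M.
Proof.
move=> subM Me; apply/seteqP; split=> [_ [c [m [Mm ->]]]|]; last exact: sub_adjoin1.
exact: subM.2.
Qed.

Lemma zero_subspace : is_subspace [set 0 : X].
Proof. by split=> // a _ _ -> ->; rewrite scaler0 addr0. Qed.

Lemma adjoin_sumP M s x : adjoin M s x <->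
  exists m k, [/\ M m, adjoin [set 0] s k & x = m + k].
Proof.
elim: s x => [|e s IH] x /=.
  split=> [Mx|[m [_ [Mm -> ->]]]]; last by rewrite addr0.
  by exists x, 0; rewrite addr0.
split=> [[c [_ [/IH[m [k [Mm sk ->]]] ->]]]|[m [_ [Mm [c [k [sk ->]]] ->]]]].
  by exists m, (c *: e + k); split=> //; [exists c, k|rewrite addrCA].
by exists c, (m + k); split; [apply/IH; exists m, k|rewrite addrCA].
Qed.

Lemma adjoinP M s x :
  adjoin M s x <-> exists c : nat -> C, M (x - \sum_(i < size s) c i *: s`_i).
Proof.
elim: s x => [|e s IH] x /=.
  split=> [Mx|[c]]; last by rewrite big_ord0 subr0.
  by exists (fun=> 0); rewrite big_ord0 subr0.
split=> [[a [m [/IH[c Mm] ->]]]|[c Mx]].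
  exists (fun k => if k is j.+1 then c j else a).
  by rewrite big_ord_recl /= opprD addrA [_ + m]addrC addrK.
exists (c 0%N), (x - c 0%N *: e); split; last by rewrite addrC subrK.
apply/IH; exists (c \o S); move: Mx; rewrite big_ord_recl /= opprD addrA.
by [].
Qed.

(** The two presentations of a finite span, by a family indexed by ordinals and
by a list, with the coset condition of [finite_codim] built in so that it
serves for dimension (base [{0}]) and codimension (base the subspace). *)
Lemma span_seq n (e : 'I_n -> X) :
  exists s, forall M x, adjoin M s x <-> exists2 v, lin_span e v & M (x - v).
Proof.
exists (mkseq (fun k => oapp e 0 (insub k)) n) => M x.
have sumE (c : nat -> C) s : size s = n -> \sum_(i < size s) c i *: s`_i =
    \sum_(i < n) c i *: s`_i.
  by move=> sn; rewrite -!(big_mkord xpredT (fun i => c i *: s`_i)) sn.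
have nthE (i : 'I_n) : (mkseq (fun k => oapp e 0 (insub k)) n)`_i = e i.
  by rewrite nth_mkseq // valK.
split=> [/adjoinP[c]|[_ [c ->] Mx]].
  rewrite sumE ?size_mkseq // => Mx.
  exists (\sum_(i < n) c i *: e i); first by exists (fun i => c i).
  by under eq_bigr do rewrite -nthE.
apply/adjoinP; exists (fun k => oapp c 0 (insub k)).
rewrite (sumE (fun k => oapp c 0 (insub k)) _ (size_mkseq _ _)).
under eq_bigr do rewrite valK nthE.
by [].
Qed.

Lemma seq_span s : exists n (e : 'I_n -> X),
  forall M x, adjoin M s x <-> exists2 v, lin_span e v & M (x - v).
Proof.
exists (size s), (fun i => s`_i) => M x; split=> [/adjoinP[c Mx]|].
  by exists (\sum_(i < size s) c i *: s`_i) => //; exists (fun i => c i).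
move=> [_ [c ->] Mx]; apply/adjoinP; exists (fun k => oapp c 0 (insub k)).
by under eq_bigr do rewrite valK.
Qed.

Lemma finite_dimP M : finite_dim M <-> exists s, M = adjoin [set 0] s.
Proof.
have span0 n (e : 'I_n -> X) x :
    (exists2 v, lin_span e v & [set 0] (x - v)) <-> lin_span e x.
  split=> [[v ev /= /eqP]|ex]; first by rewrite subr_eq0 => /eqP ->.
  by exists x => //=; rewrite subrr.
split=> [[n [e ->]]|[s ->]].
  have [s sP] := span_seq e; exists s; apply/seteqP.
  by split=> x; [move=> /span0 /sP|move=> /sP /span0].
have [n [e eP]] := seq_span s; exists n, e; apply/seteqP.
by split=> x; [move=> /eP /span0|move=> /span0 /eP].
Qed.

Lemma finite_codimP M : finite_codim M <-> exists s, adjoin M s = setT.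
Proof.
split=> [[n [e eM]]|[s sM]].
  have [s sP] := span_seq e; exists s; apply/seteqP; split=> // x _.
  exact/sP/eM.
have [n [e eP]] := seq_span s; exists n, e => x.
by apply/eP; rewrite sM.
Qed.

End OneSpace.

Section Image.
Context X Y (S : set (hsum X Y)) (subS : linear_relation S).

Definition rel_img (N : set X) : set Y := [set y | exists2 x, N x & S (x, y)].

(** Induction on the added vectors: a new vector [e] matters only if the domain
of [S] contains some [c0 e + m0] with [c0 != 0]; in that case one image [y0] of
it makes up for [e], since a multiple of [(c0 e + m0, y0)] can be subtracted
from any [(c e + m, y)] in [S] to remove its [e]-component. *)
Lemma rel_img_adjoin N s : is_subspace N ->
  exists t, rel_img (adjoin N s) = adjoin (rel_img N) t.
Proof.
move=> subN; elim: s => [|e s IH] /=; first by exists [::].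
have [t tP] := IH.
have subL := adjoin_subspace s subN; pose L := adjoin N s; rewrite -/L in tP subL *.
have [[c0 [m0 [y0 [c0_neq0 Lm0 S0]]]]|no] := pselect (exists (c : C) m y,
    [/\ c != 0, L m & S (c *: e + m, y)]).
  exists (y0 :: t); rewrite /= -tP; apply/seteqP; split=> y.
    move=> [_ [c [m [Lm ->]]] Sxy].
    exists (c / c0), (y - (c / c0) *: y0); split; last by rewrite addrC subrK.
    exists (m - (c / c0) *: m0).
      by apply: subspaceB => //; exact: subspaceZ.
    have := relB subS Sxy (relZ subS (c / c0) S0).
    rewrite scalerDr scalerA divfK // opprD addrACA subrr add0r.
    by [].
  move=> [a [y' [[x Lx Sxy] ->]]].
  exists (a *: (c0 *: e + m0) + x); last exact: (relD subS (relZ subS a S0) Sxy).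
  exists (a * c0), (a *: m0 + x); split; first exact: subL.2.
  by rewrite scalerDr scalerA addrA.
exists t; rewrite -tP; apply/seteqP; split=> y.
  move=> [_ [c [m [Lm ->]]] Sxy]; have [c0|c_neq0] := eqVneq c 0; last first.
    by case: no; exists c, m, y.
  by exists m => //; rewrite c0 scale0r add0r in Sxy.
by move=> [x Lx Sxy]; exists x => //; exact: sub_adjoin1.
Qed.

End Image.

Lemma finite_dim_img X Y (S : set (hsum X Y)) (N : set X) :
  linear_relation S -> finite_dim (rel_mul S) -> finite_dim N ->
  finite_dim (rel_img S N).
Proof.
move=> subS /finite_dimP[m mulS] /finite_dimP[s ->]; apply/finite_dimP.
have [t ->] := rel_img_adjoin subS s (@zero_subspace X).
have -> : rel_img S [set 0] = rel_mul S.
  by apply/seteqP; split=> [y [_ ->]//|y Sy]; exists 0.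
by exists (t ++ m); rewrite adjoin_cat -mulS.
Qed.

(** [M] is the image of [N] under the identity relation of [M], which is
single-valued. *)
Lemma finite_dim_sub X (M N : set X) :
  is_subspace M -> M `<=` N -> finite_dim N -> finite_dim M.
Proof.
move=> subM MN fdN; pose S : set (hsum X X) := [set p | M p.1 /\ p.2 = p.1].
have subS : linear_relation S.
  split=> [|a [x x'] [y y'] [/= Mx ->] [/= My ->]].
    by split=> //; exact: (subspace0 subM).
  by split=> //; exact: subM.2.
have -> : M = rel_img S N.
  apply/seteqP; split=> [x Mx|_ [x Nx [/= Mx ->]]] //.
  by exists x => //; exact: MN.
apply: finite_dim_img => //; apply/finite_dimP; exists [::].
apply/seteqP; split=> [x [/= _ ->]|_ ->] //=.
by split=> //=; exact: (subspace0 subM).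
Qed.

Section Closed.
Context X.
Implicit Types (M : set X) (e : X).

Lemma inner_eq0C (x y : X) : inner x y = 0 -> inner y x = 0.
Proof.
have -> : inner y x = Num.conj (inner x y) by rewrite hermC expr0 mul1r.
by move=> ->; rewrite rmorph0.
Qed.

Lemma le_rnorm_orthogonalD (x y : X) : inner x y = 0 -> rnorm x <= rnorm (x + y).
Proof.
move=> xy; rewrite -lecR -!rnormE -(@ler_pXn2r _ 2) ?nnegrE ?normr_ge0 //.
rewrite -!innerE linearDl !linearDr /= xy (inner_eq0C xy) addr0 add0r.
by rewrite lerDl innerE exprn_ge0.
Qed.

(** The orthogonal projection of [x] on the line is at least as close to [x] as
any other point of the line, hence equals [x] when [x] is in the closure. *)
Lemma line_closed e : closed (adjoin1 e [set 0]).
Proof.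
apply/closedP => x xe.
have [e0|e_neq0] := eqVneq e 0.
  rewrite adjoin1_id ?e0 //= in xe *; last exact: zero_subspace.
  apply: small_rnorm_eq0 => d /xe [_ ->].
  by rewrite subr0 => /ltW.
have ee_neq0 : inner e e != 0 by rewrite innerE expf_neq0 // normr_eq0.
pose c0 := inner x e / inner e e.
have xe0 : inner (x - c0 *: e) e = 0.
  by rewrite linearBl /= linearZl_LR /= /c0 divfK ?subrr.
exists c0, 0; split=> //; rewrite addr0; apply/eqP; rewrite -subr_eq0; apply/eqP.
apply: small_rnorm_eq0 => d /xe [_ [c [_ [-> ->]]]].
rewrite addr0 => /ltW; apply: le_trans.
have -> : x - c *: e = x - c0 *: e + (c0 - c) *: e by rewrite scalerBl addrA subrK.
by apply: le_rnorm_orthogonalD; rewrite linearZr_LR /= xe0 mulr0.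
Qed.

(** For [e] at distance [d > 0] from [M], the [e]-component of [c e + m] is
bounded by [rnorm e / d] times the whole vector.  So approximations of [w] in
[M + C e] that converge fast enough have [e]-components which converge, to a
point of the line by [line_closed]; the other components then converge to a
point of [M]. *)
Lemma adjoin1_closed e M : is_subspace M -> closed M -> closed (adjoin1 e M).
Proof.
move=> subM Mc; have [Me|nMe] := pselect (M e); first by rewrite adjoin1_id.
have [d d0 dM] : exists2 d : R, 0 < d & forall m, M m -> d <= rnorm (e - m).
  apply: contrapT => far; apply: nMe; apply: ((closedP M).1 Mc) => d d0.
  apply: contrapT => noM; apply: far; exists d => // m Mm.
  by rewrite leNgt; apply/negP => em; apply: noM; exists m.
pose k := rnorm e / d.
have k0 : 0 <= k by rewrite divr_ge0 ?rnorm_ge0 // ltW.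
have bound (c : C) m : M m -> rnorm (c *: e) <= k * rnorm (c *: e + m).
  move=> Mm; have [->|c_neq0] := eqVneq c 0.
    by rewrite scale0r rnorm0 mulr_ge0 // rnorm_ge0.
  have -> : c *: e + m = c *: (e - (- c^-1) *: m).
    by rewrite scaleNr opprK scalerDr scalerA mulfV // scale1r.
  rewrite !rnormZ mulrCA ler_wpM2l //.
    by rewrite -ler0c RRe_real ?normr_real.
  rewrite /k mulrAC ler_pdivlMr // ler_wpM2l ?rnorm_ge0 //.
  by apply: dM; exact: subspaceZ.
apply/closedP => w wM; pose r j : R := 1 / 2 ^+ j.
have r0 j : 0 < r j by rewrite divr_gt0 ?exprn_gt0.
have r2 j : 2 * r j.+1 <= r j.
  by rewrite /r exprS !div1r invfM mulrA mulfV // mul1r.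
have pick j : exists p : C * X, M p.2 /\ rnorm (w - (p.1 *: e + p.2)) < r j.
  by have [_ [c [m [Mm ->]]] wr] := wM _ (r0 j); exists (c, m).
have [p pP] := choice pick.
(* [2 * k * r j] bounds the steps of the [e]-components; the extra [r j] makes
   [r'] positive and larger than [r] even for [k = 0]. *)
pose r' j := (2 * k + 1) * r j.
have k1 : 0 < 2 * k + 1 by rewrite ltr_wpDl // mulr_ge0.
have r'0 j : 0 < r' j by rewrite mulr_gt0.
have r'2 j : 2 * r' j.+1 <= r' j by rewrite /r' mulrCA ler_pM2l.
have [j|l lP] := halving_cvg (u := fun j => (p j).1 *: e) r'0 r'2.
  have [Mj wj] := pP j; have [Mj1 wj1] := pP j.+1.
  rewrite -scalerBl; apply: le_trans (bound _ _ (subspaceB subM Mj Mj1)) _.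
  have -> : ((p j).1 - (p j.+1).1) *: e + ((p j).2 - (p j.+1).2) =
      ((p j).1 *: e + (p j).2) - ((p j.+1).1 *: e + (p j.+1).2).
    by rewrite scalerBl opprD addrACA.
  apply: (@le_trans _ _ (k * (2 * r j))).
    rewrite ler_wpM2l //.
    have := rnorm_triangle w ((p j).1 *: e + (p j).2)
                             ((p j.+1).1 *: e + (p j.+1).2).
    rewrite (rnormB _ w); have := r2 j; have := r0 j; have := r0 j.+1; lra.
  by rewrite /r'; have := r0 j; move: (r j) => rj; lra.
have [c [_ [-> /esym cl]]] : adjoin1 e [set 0] l.
  apply: ((closedP _).1 (line_closed (e := e))) => h h0.
  have [N /(_ _ (leqnn N)) rN] := half_decay r'0 r'2 (divr_gt0 h0 (ltr0n _ 2)).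
  exists ((p N).1 *: e); first by exists (p N).1, 0; rewrite addr0.
  by rewrite rnormB; have := lP N; lra.
exists c, (w - l); rewrite -cl addr0 [RHS]addrC subrK; split=> //.
apply: ((closedP _).1 Mc) => h h0.
have [N /(_ _ (leqnn N)) rN] := half_decay r'0 r'2 (divr_gt0 h0 (ltr0n _ 4)).
have [M' wN] := pP N; exists (p N).2 => //.
rewrite -cl addr0 in lP.
have -> : w - c *: e - (p N).2 = (w - ((p N).1 *: e + (p N).2)) + ((p N).1 *: e - c *: e).
  by rewrite (addrC _ (p N).2) opprD (addrA w) subrKA addrAC.
have := rnormD (w - ((p N).1 *: e + (p N).2)) ((p N).1 *: e - c *: e).
have := lP N.
have : r N <= r' N by rewrite /r'; have := mulr_ge0 k0 (ltW (r0 N)); lra.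
lra.
Qed.

Lemma adjoin_closed s M : is_subspace M -> closed M -> closed (adjoin M s).
Proof.
move=> subM Mc; elim: s => //= e s IH.
by apply: adjoin1_closed => //; exact: adjoin_subspace.
Qed.

End Closed.

(** * Ranges that are closed up to finitely many vectors *)

Section Kato.
Context X Y.
Implicit Types (S : set (hsum X Y)) (e : Y) (s : seq Y).

Lemma adjoin1_CR S (e : hsum X Y) : CR S -> CR (adjoin1 e S).
Proof.
by move=> [subS Sc]; split; [exact: adjoin1_subspace|exact: adjoin1_closed].
Qed.

Lemma rel_ran_adjoin1 S e :
  rel_ran (adjoin1 ((0, e) : hsum X Y) S) = adjoin1 e (rel_ran S).
Proof.
apply/seteqP; split=> [y [x [c [[x' y'] [Sxy]]]]|_ [c [y [[x Sxy] ->]]]].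
  by move=> [_ ->]; exists c, y'; split=> //; exists x'.
exists x, c, (x, y); split=> //.
by congr (_, _); rewrite /= scaler0 add0r.
Qed.

(** Apply the open mapping theorem to the relation [G] that keeps track of the
part of [w] taken along [e]: [((x, c e), y + c e)] for [(x, y)] in [S].  A
point [w = y + c e] of the closure of [rel_ran S] is close to some [v] in
[rel_ran S], so [w - v] is the value of [G] at a small [(x, b e)]; when [e] is
not in [rel_ran S] this forces [c = b], so [c e] is arbitrarily small. *)
Lemma adjoin1_ran_closed S e :
  CR S -> closed (adjoin1 e (rel_ran S)) -> closed (rel_ran S).
Proof.
move=> [subS Sc] Rc; have subR := rel_ran_subspace subS.
have [Re|nRe] := pselect (rel_ran S e); first by rewrite adjoin1_id in Rc.
pose G : set (hsum (hsum X Y) Y) := [set p |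
  adjoin1 e [set 0] p.1.2 /\ S (p.1.1, p.2 - p.1.2)].
have subL := adjoin1_subspace e (@zero_subspace Y).
have CRG : CR G.
  split.
    split=> [|a [[x f] w] [[x' f'] w'] [/= Lf Sxw] [/= Lf' Sxw']].
      by split=> /=; [exact: subspace0 subL|rewrite subr0; exact: subspace0 subS].
    split=> /=; first exact: subL.2.
    have := relD subS (relZ subS a Sxw) Sxw'.
    by rewrite scalerBr opprD addrACA.
  apply/closed_relP => -[x f] w xfw; split=> /=.
    apply: ((closedP _).1 (line_closed (e := e))) => d /xfw[[x' f'] [w' [[/= Lf' _] xf _]]].
    exists f' => //; apply: le_lt_trans xf.
    exact: (rnorm_snd ((x, f) - (x', f') : hsum X Y)).
  apply: ((closed_relP _).1 Sc) => d d0.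
  have [[x' f'] [w' [[/= _ Sxw'] xf ww]]] := xfw _ (divr_gt0 d0 (ltr0n _ 2)).
  exists x', (w' - f'); split=> //.
    apply: le_lt_trans (_ : d / 2 < d); last lra.
    apply: le_trans (ltW xf); exact: (rnorm_fst ((x, f) - (x', f') : hsum X Y)).
  have : rnorm (f - f') < d / 2.
    apply: le_lt_trans xf; exact: (rnorm_snd ((x, f) - (x', f') : hsum X Y)).
  have -> : w - f - (w' - f') = (w - w') - (f - f') by rewrite !opprD addrACA.
  have := rnormD (w - w') (- (f - f')); rewrite rnormN; lra.
have ranG : rel_ran G = adjoin1 e (rel_ran S).
  apply/seteqP; split=> [w [[x f] [/= [c [_ [-> fE]]] Sxw]]|_ [c [y [[x Sxy] ->]]]].
    exists c, (w - f); split; first by exists x.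
    by rewrite fE addr0 [RHS]addrC subrK.
  exists (x, c *: e); split=> /=; first by exists c, 0; rewrite addr0.
  by rewrite addrAC subrr add0r.
have Gc : closed (rel_ran G) by rewrite ranG.
apply/closedP => w wR.
have [c [y [Ry wE]]] : adjoin1 e (rel_ran S) w.
  apply: ((closedP _).1 Rc) => d /wR[v Rv wv]; exists v => //.
  exact: sub_adjoin1.
suff ce0 : c *: e = 0 by rewrite wE ce0 add0r.
apply: small_rnorm_eq0 => d d0.
have [h h0 hP] := open_mapping_near CRG Gc d0; rewrite ranG in hP.
have [v Rv wv] := wR _ h0.
have Lwv : adjoin1 e (rel_ran S) (w - v).
  by exists c, (y - v); split; [exact: subspaceB|rewrite wE addrA].
have [[x f] [/= [b [_ [-> fE]]] Sxf] xfd] := hP _ Lwv wv.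
rewrite addr0 in fE; have {fE} fE : f = b *: e := fE.
have cb : c = b.
  apply: contrapT => /eqP cb; apply: nRe.
  have cb0 : c - b != 0 by rewrite subr_eq0.
  rewrite -[e](scalerK cb0); apply: subspaceZ => //.
  have -> : (c - b) *: e = (w - v - f) - (y - v).
    by rewrite wE fE scalerBl opprB (addrAC _ (- v)) subrKA addrAC addrK.
  by apply: subspaceB => //; [exists x|exact: subspaceB].
rewrite cb -fE; apply: le_trans (rnorm_snd ((x, f) : hsum X Y)) _.
exact: ltW.
Qed.

(** Adding vectors to the range of [S] amounts to adjoining them to the
multivalued part of [S], which keeps the relation closed; so the added vectors
can be dropped one at a time. *)
Lemma adjoin_ran_closed s S :
  CR S -> closed (adjoin (rel_ran S) s) -> closed (rel_ran S).
Proof.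
move=> CRS; pose G s := adjoin S [seq ((0, e) : hsum X Y) | e <- s].
have CRG t : CR (G t) by elim: t => //= e t; exact: adjoin1_CR.
have ranG t : rel_ran (G t) = adjoin (rel_ran S) t.
  by elim: t => //= e t <-; exact: rel_ran_adjoin1.
elim: s => //= e s IH Rc; apply: IH; rewrite -ranG in Rc *.
exact: adjoin1_ran_closed Rc.
Qed.

End Kato.
End Adjunction.

(** * Products of semi-Fredholm relations *)

Lemma finite_codim_ran_closed (R : realType) (X Y : hilbertType R)
    (S : set (hsum X Y)) : CR S ->
  finite_codim (rel_ran S) -> closed (rel_ran S).
Proof.
move=> CRS /finite_codimP[s sT]; apply: (adjoin_ran_closed (s := s)) => //.
by rewrite sT; exact: closedT.
Qed.

Section Compositions.
Context (R : realType) (X Y Z : hilbertType R).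
Implicit Types (S : set (hsum X Y)) (U : set (hsum Y Z)).

Lemma rel_ran_comp U S : rel_ran (rel_comp U S) = rel_img U (rel_ran S).
Proof.
apply/seteqP; split=> [w [x [y Sxy Uyw]]|w [y [x Sxy] Uyw]].
  by exists y => //; exists x.
by exists x, y.
Qed.

Lemma rel_ker_comp U S :
  rel_ker (rel_comp U S) = rel_img (rel_inv S) (rel_ker U).
Proof. by apply/seteqP; split=> x [y]; exists y. Qed.

Lemma phi_minus_comp U S : CR (rel_comp U S) ->
  phi_minus U -> phi_minus S -> phi_minus (rel_comp U S).
Proof.
move=> CRP [[subU _] _ /finite_codimP[u uT]] [[subS _] _ /finite_codimP[s sT]].
have fc : finite_codim (rel_ran (rel_comp U S)).
  apply/finite_codimP; rewrite rel_ran_comp.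
  have [t tE] := rel_img_adjoin subU s (rel_ran_subspace subS).
  exists (u ++ t); rewrite adjoin_cat -tE sT -uT; congr (adjoin _ u).
  by apply/seteqP; split=> w [y]; [move=> _|]; exists y.
by split=> //; exact: finite_codim_ran_closed.
Qed.

Lemma phi_minus_compl U S : CR U ->
  phi_minus (rel_comp U S) -> phi_minus U.
Proof.
move=> CRU [_ _ /finite_codimP[s sT]].
have fc : finite_codim (rel_ran U).
  apply/finite_codimP; exists s; apply/seteqP; split=> // w _.
  have : adjoin (rel_ran (rel_comp U S)) s w by rewrite sT.
  by apply: adjoin_mono => {}w [x [y _ Uyw]]; exists y.
by split=> //; exact: finite_codim_ran_closed.
Qed.

(** The range of [U S] is the image under [U] of the closed subspace
[L = R(S) + N(U)].  It is closed because [U] is open onto its range: a point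
[w] close to a value of [U] on [L] has a preimage close to [L], and since [L]
contains [N(U)] every preimage of [w] is then in the closure of [L]. *)
Lemma phi_plus_comp U S : CR (rel_comp U S) ->
  phi_plus U -> phi_plus S -> phi_plus (rel_comp U S).
Proof.
move=> CRP [CRU UR Uk] [[subS _] SR Sk]; have subU := CRU.1.
split=> //; last first.
  by rewrite rel_ker_comp; exact: finite_dim_img (rel_inv_subspace subS) Sk Uk.
have [s sE] := (finite_dimP _).1 Uk.
have subR := rel_ran_subspace subS.
have Yc := adjoin_closed (s := s) subR SR.
have subY := adjoin_subspace s subR.
have kerY y : rel_ker U y -> adjoin (rel_ran S) s y.
  rewrite sE; apply: adjoin_mono => _ ->; exact: subspace0 subR.
apply/closedP => w wP.
have [z Uzw] : rel_ran U w.
  apply: ((closedP _).1 UR) => d /wP[v [x [y _ Uyv]] wv]; exists v => //.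
  by exists y.
have /adjoin_sumP[y1 [y2 [[x Sxy1] + zE]]] : adjoin (rel_ran S) s z.
  apply: ((closedP _).1 Yc) => d d0.
  have [h h0 hP] := open_mapping_near CRU UR d0.
  have [v [x [y Sxy Uyv]] wv] := wP _ h0.
  have [|z' Uz' z'd] := hP (w - v) _ wv; first by exists (z - y); exact: relB.
  exists (z - z'); last by rewrite subKr.
  have -> : z - z' = y + (z - z' - y) by rewrite [RHS]addrC subrK.
  apply: subspaceD => //; first by apply: sub_adjoin; exists x.
  apply: kerY.
  have := relB subU (relB subU Uzw Uz') Uyv.
  by rewrite subKr subrr.
rewrite -sE => Uy2; exists x, y1 => //=.
by have := relB subU Uzw Uy2; rewrite zE addrK subr0.
Qed.

End Compositions.

Section Factors.
Context (R : realType) (X Y Z : hilbertType R).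

(** [R(S) + N(U)] is the preimage under [U] of the closed set [R(U S)].  The
open mapping theorem for the inverse of [U] says that [U] maps nearby points to
sets with nearby elements, so this preimage is closed; as [N(U)] has finite
dimension, [R(S)] is closed too. *)
Lemma phi_plus_compr (U : set (hsum Y Z)) (S : set (hsum X Y)) :
  CR U -> rel_dom U = setT -> finite_dim (rel_ker U) -> CR S ->
  phi_plus (rel_comp U S) -> phi_plus S.
Proof.
move=> CRU domU Uk CRS [_ Pc Pk]; have [subU _] := CRU; have [subS _] := CRS.
split=> //; last first.
  apply: (finite_dim_sub _ _ Pk); first exact: rel_ker_subspace.
  by move=> x Sx; exists 0 => //; exact: (subspace0 subU).
have [s sE] := (finite_dimP _).1 Uk.
apply: (adjoin_ran_closed (s := s)) => //.
have ranV : rel_ran (rel_inv U) = setT by rewrite -domU.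
have Vc : closed (rel_ran (rel_inv U)) by rewrite ranV; exact: closedT.
apply/closedP => z zP; have [w Uzw] : rel_dom U z by rewrite domU.
have [x [u Sxu Uuw]] : rel_ran (rel_comp U S) w.
  apply: ((closedP _).1 Pc) => d d0.
  have [h h0 hP] := open_mapping_near (rel_inv_CR CRU) Vc d0.
  have [y + zy] := zP _ h0.
  move=> /adjoin_sumP[y1 [y2 [[x Sxy1] + yE]]]; rewrite -sE => Uy2.
  have [|v Uv vd] := hP (z - y) _ zy; first by rewrite ranV.
  exists (w - v); last by rewrite subKr.
  exists x, y1 => //=; have := relB subU (relB subU Uzw Uv) Uy2.
  by rewrite subKr yE addrK subr0.
apply/adjoin_sumP; exists u, (z - u); split; first by exists x.
  by rewrite -sE; have := relB subU Uzw Uuw; rewrite subrr.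
by rewrite [RHS]addrC subrK.
Qed.

End Factors.

(** * Images and preimages under linear maps *)

Lemma linear_map0 (R : realType) (X Y : hilbertType R) (f : X -> Y) :
  linear f -> f 0 = 0.
Proof.
by move=> linf; have := linf (-1) 0 0; rewrite scaler0 addr0 scaleN1r addNr.
Qed.

Section LinearMaps.
Context (R : realType) (X Y : hilbertType R) (f : X -> Y).
Hypothesis linf : linear f.

Let graph : set (hsum X Y) := [set p | p.2 = f p.1].

Let f0 := linear_map0 linf.

Let graph_linear : linear_relation graph.
Proof.
split=> [|a [x y] [x' y']]; rewrite /graph /= ?f0 //.
by move=> -> ->; rewrite linf.
Qed.

Let imgE N : f @` N = rel_img graph N.
Proof.
by apply/seteqP; split=> y [x Nx /= xy]; exists x; rewrite /graph /= ?xy.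
Qed.

Lemma finite_dim_image N : finite_dim N -> finite_dim (f @` N).
Proof.
rewrite imgE; apply: finite_dim_img => //; apply/finite_dimP; exists [::].
by apply/seteqP; split=> y; rewrite /graph /= /rel_mul /= f0.
Qed.

Lemma finite_codim_image N : range f = setT -> is_subspace N ->
  finite_codim N -> finite_codim (f @` N).
Proof.
move=> surj subN /finite_codimP[s sT]; apply/finite_codimP.
have [t tE] := rel_img_adjoin graph_linear s subN.
by exists t; rewrite imgE -tE sT -imgE.
Qed.

End LinearMaps.

Lemma closed_involution (R : realType) (X : hilbertType R) (f : X -> X)
    (A : set X) :
  linear f -> involutive f -> (forall x, rnorm (f x) = rnorm x) ->
  closed A -> closed (f @` A).
Proof.
move=> linf fK fN /closedP Ac; apply/closedP => x xA; exists (f x) => //.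
apply: Ac => d /xA[_ [y Ay <-] xy]; exists y => //.
suff -> : f x - y = f (x - f y) by rewrite fN.
have -> : x - f y = -1 *: f y + x by rewrite scaleN1r addrC.
by rewrite linf fK scaleN1r addrC.
Qed.

Section Involutions.
Context (R : realType) (X Y : hilbertType R).

Variables (f : X -> X) (g : Y -> Y) (S S' : set (hsum X Y)).
Hypotheses (linf : linear f) (fK : involutive f).
Hypotheses (ling : linear g) (gK : involutive g).
Hypothesis gN : forall y, rnorm (g y) = rnorm y.
Hypothesis SS' : forall x y, S' (x, y) <-> S (f x, g y).
Hypothesis CRS' : CR S'.

Let g0 := linear_map0 ling.

Let ranE : rel_ran S' = g @` rel_ran S.
Proof.
apply/seteqP; split=> [y [x /SS' Sxy]|_ [y [x Sxy] <-]].
  by exists (g y) => //; exists (f x).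
by exists (f x); apply/SS'; rewrite fK gK.
Qed.

Let kerE : rel_ker S' = f @` rel_ker S.
Proof.
apply/seteqP; split=> [x /SS' Sx|_ [x Sx <-]].
  by exists (f x) => //; rewrite g0 in Sx.
by apply/SS'; rewrite fK g0.
Qed.

Lemma phi_plus_conj : phi_plus S -> phi_plus S'.
Proof.
move=> [_ Rc Kf]; split=> //; first by rewrite ranE; exact: closed_involution.
by rewrite kerE; exact: finite_dim_image.
Qed.

Lemma phi_minus_conj : phi_minus S -> phi_minus S'.
Proof.
move=> [[subS _] Rc Rf]; split=> //.
  by rewrite ranE; exact: closed_involution.
rewrite ranE; apply: finite_codim_image => //; last exact: rel_ran_subspace.
by apply/seteqP; split=> // y _; exists (g y).
Qed.

End Involutions.

Section Pullback.
Context (R : realType) (X Y X' Y' : hilbertType R).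

Lemma CR_setI (S S' : set (hsum X Y)) : CR S -> CR S' -> CR (S `&` S').
Proof.
move=> [subS Sc] [subS' Sc']; split; last exact: closedI.
split; first by split; [case: subS|case: subS'].
by move=> a p q [Sp Sp'] [Sq Sq']; split; [exact: subS.2|exact: subS'.2].
Qed.

Lemma CR_preimage (f : X -> X') (g : Y -> Y') (S : set (hsum X' Y')) :
  linear f -> linear g ->
  (forall x, rnorm (f x) <= rnorm x) -> (forall y, rnorm (g y) <= rnorm y) ->
  CR S -> CR [set p : hsum X Y | S (f p.1, g p.2)].
Proof.
move=> linf ling fN gN [subS Sc].
have linB (V W : hilbertType R) (h : V -> W) u v :
    linear h -> h u - h v = h (u - v).
  move=> linh; have := linh (-1) v u.
  by rewrite !scaleN1r [- v + u]addrC [- h v + h u]addrC.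
split.
  split=> [|a [x y] [x' y'] /= Sxy Sxy'].
    by rewrite /= !linear_map0 //; exact: (subspace0 subS).
  by rewrite /= linf ling; exact: (relD subS (relZ subS a Sxy) Sxy').
apply/closed_relP => x y xyS; apply: ((closed_relP _).1 Sc) => d.
move=> /xyS[x' [y' [Sxy xx yy]]]; exists (f x'), (g y'); split=> //.
  by rewrite linB //; exact: le_lt_trans (fN _) xx.
by rewrite linB //; exact: le_lt_trans (gN _) yy.
Qed.

End Pullback.

(** * Direct sums of relations *)

Section Products.
Context (R : realType) (H K : hilbertType R).
Local Notation HK := (hsum H K).

Definition hprod (M : set H) (N : set K) : set HK :=
  [set p : HK | M p.1 /\ N p.2].

Lemma hprod_fst M N : N 0 -> (fun p : HK => p.1 : H) @` hprod M N = M.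
Proof.
move=> N0; apply/seteqP; split=> [_ [p [Mp _] <-]//|x Mx].
by exists ((x, 0) : HK).
Qed.

Lemma hprod_snd M N : M 0 -> (fun p : HK => p.2 : K) @` hprod M N = N.
Proof.
move=> M0; apply/seteqP; split=> [_ [p [_ Np] <-]//|x Nx].
by exists ((0, x) : HK).
Qed.

Lemma hprod_subspace M N : is_subspace M -> is_subspace N ->
  is_subspace (hprod M N).
Proof.
move=> subM subN; split; first by split; [case: subM|case: subN].
move=> a [x y] [x' y'] [/= Mx Ny] [/= Mx' Ny'].
by split; [exact: subM.2|exact: subN.2].
Qed.

Lemma closed_hprod M N : is_subspace M -> is_subspace N ->
  closed (hprod M N) <-> closed M /\ closed N.
Proof.
move=> [M0 _] [N0 _]; split=> [/closedP MNc|[/closedP Mc /closedP Nc]].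
  split; apply/closedP => x xM.
    suff [] : hprod M N ((x, 0) : HK) by [].
    apply: MNc => d /xM[y My xy]; exists ((y, 0) : HK) => //.
    by apply: le_lt_trans (rnorm_pair _) _; rewrite /= subrr rnorm0 addr0.
  suff [] : hprod M N ((0, x) : HK) by [].
  apply: MNc => d /xM[y My xy]; exists ((0, y) : HK) => //.
  by apply: le_lt_trans (rnorm_pair _) _; rewrite /= subrr rnorm0 add0r.
apply/closedP => p pMN; split.
  apply: Mc => d /pMN[q [Mq _] pq]; exists q.1 => //.
  exact: le_lt_trans (rnorm_fst (p - q)) pq.
apply: Nc => d /pMN[q [_ Nq] pq]; exists q.2 => //.
exact: le_lt_trans (rnorm_snd (p - q)) pq.
Qed.

Lemma linear_fst : linear (fun p : HK => p.1 : H). Proof. by []. Qed.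
Lemma linear_snd : linear (fun p : HK => p.2 : K). Proof. by []. Qed.

Let cyl (N : set K) : set (hsum H HK) := [set p | p.2.1 = p.1 /\ N p.2.2].

Let cyl_linear N : is_subspace N -> linear_relation (cyl N).
Proof.
move=> subN; split; first by split=> //; exact: (subspace0 subN).
move=> a [x [y z]] [x' [y' z']] [/= -> Nz] [/= -> Nz'].
by split=> //; exact: subN.2.
Qed.

Let cyl_img M N : rel_img (cyl N) M = hprod M N.
Proof.
apply/seteqP; split=> [[y z] [x Mx [/= -> Nz]]|[x z] [/= Mx Nz]] //.
by exists x.
Qed.

(** [M * N] is the image of [M] under the relation [cyl N], whose multivalued
part is [0 * N]; conversely the factors are projections of the product. *)
Lemma finite_dim_hprod M N : is_subspace M -> is_subspace N ->
  finite_dim (hprod M N) <-> finite_dim M /\ finite_dim N.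
Proof.
move=> [M0 _] subN; have [N0 _] := subN; split=> [MNf|[Mf Nf]].
  split; first by rewrite -(hprod_fst M N0); exact: (finite_dim_image linear_fst MNf).
  by rewrite -(hprod_snd N M0); exact: (finite_dim_image linear_snd MNf).
rewrite -cyl_img; apply: finite_dim_img => //; first exact: cyl_linear.
have -> : rel_mul (cyl N) = (fun y : K => (0, y) : HK) @` N.
  by apply/seteqP; split=> [[x y] [/= -> Ny]|_ [y Ny <-]] //; exists y.
apply: finite_dim_image Nf => a x y; congr (_, _).
by rewrite /= scaler0 addr0.
Qed.

(** The same relation [cyl N] takes [M * N] to [H * N] by adding finitely many
vectors, and the symmetric relation takes [H * N] to the whole space. *)
Lemma finite_codim_hprod M N : is_subspace M -> is_subspace N ->
  finite_codim (hprod M N) <-> finite_codim M /\ finite_codim N.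
Proof.
move=> subM subN; have [M0 _] := subM; have [N0 _] := subN.
have subMN := hprod_subspace subM subN.
split=> [MNf|[/finite_codimP[s sT] /finite_codimP[t tT]]].
  split.
    rewrite -(hprod_fst M N0); apply: (finite_codim_image linear_fst _ subMN MNf).
    by apply/seteqP; split=> // x _; exists ((x, 0) : HK).
  rewrite -(hprod_snd N M0); apply: (finite_codim_image linear_snd _ subMN MNf).
  by apply/seteqP; split=> // x _; exists ((0, x) : HK).
have [s' s'E] := rel_img_adjoin (cyl_linear subN) s subM.
pose S : set (hsum K HK) := [set p | p.2.2 = p.1].
have subS : linear_relation S.
  by split=> // a [x [y z]] [x' [y' z']]; rewrite /S /= => -> ->.
have [t' t'E] := rel_img_adjoin subS t subN.
apply/finite_codimP; exists (t' ++ s'); rewrite adjoin_cat -cyl_img -s'E sT.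
have -> : rel_img (cyl N) setT = rel_img S N.
  rewrite cyl_img; apply/seteqP; split=> [[x y] [_ /= Ny]|[x y] [z Nz]].
    by exists y.
  by rewrite /S /= => ->.
by rewrite -t'E tT; apply/seteqP; split=> // -[x y] _; exists y.
Qed.

Definition rel_dsum (D : set (hsum H H)) (E : set (hsum K K)) : set (hsum HK HK) :=
  [set p : hsum HK HK | D (p.1.1, p.2.1) /\ E (p.1.2, p.2.2)].

Lemma rel_dsum_CR D E : CR D -> CR E -> CR (rel_dsum D E).
Proof.
move=> CRD CRE; apply: CR_setI.
  exact: CR_preimage linear_fst linear_fst (@rnorm_fst _ H K) (@rnorm_fst _ H K) CRD.
exact: CR_preimage linear_snd linear_snd (@rnorm_snd _ H K) (@rnorm_snd _ H K) CRE.
Qed.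

Section Dsum.
Variables (D : set (hsum H H)) (E : set (hsum K K)).
Hypotheses (CRD : CR D) (CRE : CR E).

Let ranE : rel_ran (rel_dsum D E) = hprod (rel_ran D) (rel_ran E).
Proof.
apply/seteqP; split=> [y [x [Dx Ex]]|y [[x Dx] [x' Ex]]].
  by split; [exists x.1|exists x.2].
by exists ((x, x') : HK).
Qed.

Let subD := rel_ran_subspace CRD.1.
Let subE := rel_ran_subspace CRE.1.

Lemma phi_plus_dsum :
  phi_plus (rel_dsum D E) <-> phi_plus D /\ phi_plus E.
Proof.
have kD := rel_ker_subspace CRD.1; have kE := rel_ker_subspace CRE.1.
split=> [[_]|[[_ Dc Df] [_ Ec Ef]]].
  rewrite ranE => /(closed_hprod subD subE)[Dc Ec].
  by move=> /(finite_dim_hprod kD kE)[Df Ef].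
split; first exact: rel_dsum_CR.
  by rewrite ranE; exact/closed_hprod.
exact/(finite_dim_hprod kD kE).
Qed.

Lemma phi_minus_dsum :
  phi_minus (rel_dsum D E) <-> phi_minus D /\ phi_minus E.
Proof.
split=> [[_]|[[_ Dc Df] [_ Ec Ef]]]; rewrite ?ranE.
  move=> /(closed_hprod subD subE)[Dc Ec].
  by move=> /(finite_codim_hprod subD subE)[Df Ef].
split; rewrite ?ranE; [exact: rel_dsum_CR|exact/closed_hprod|].
exact/finite_codim_hprod.
Qed.

End Dsum.
End Products.

(** * Shifts and the antidiagonal relation *)

Section Shift.
Context (R : realType) (X : hilbertType R).
Implicit Types (T : set (hsum X X)) (l : R[i]).

Lemma rel_shiftE T l x y : rel_shift T l (x, y) <-> T (x, y + l *: x).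
Proof.
split=> [[z Txz /= ->]|Txy]; first by rewrite subrK.
by exists (y + l *: x) => //=; rewrite addrK.
Qed.

Lemma rel_shift_CR T l : CR T -> CR (rel_shift T l).
Proof.
move=> [subT Tc]; split.
  split=> [|a [x y] [x' y'] /rel_shiftE Txy /rel_shiftE Txy'].
    by apply/rel_shiftE; rewrite scaler0 addr0; exact: (subspace0 subT).
  apply/rel_shiftE; have := relD subT (relZ subT a Txy) Txy'.
  by rewrite !scalerDr !scalerA (mulrC a) addrACA.
apply/closed_relP => x y xyT; apply/rel_shiftE.
apply: ((closed_relP _).1 Tc) => d d0.
pose k := complex.Re `|l|.
have k0 : 0 <= k by rewrite -ler0c RRe_real ?normr_real.
have k1 : 0 < k + 1 by rewrite ltr_wpDl.
have dk : d / (k + 1) <= d by rewrite ler_pdivrMr // ler_pMr // lerDr.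
have [x' [y' [/rel_shiftE Txy xx yy]]] := xyT _ (divr_gt0 d0 k1).
exists x', (y' + l *: x'); split=> //; first exact: lt_le_trans xx dk.
have -> : y + l *: x - (y' + l *: x') = (y - y') + l *: (x - x').
  by rewrite opprD addrACA scalerBr.
apply: le_lt_trans (rnormD _ _) _; rewrite rnormZ -/k.
have -> : d = d / (k + 1) + k * (d / (k + 1)) by field; rewrite gt_eqF.
by rewrite ltr_leD // ler_wpM2l // ltW.
Qed.

Lemma rel_shift_dom T l : rel_dom T = setT -> rel_dom (rel_shift T l) = setT.
Proof.
move=> domT; apply/seteqP; split=> // x _.
have [y Txy] : rel_dom T x by rewrite domT.
by exists (y - l *: x); apply/rel_shiftE; rewrite subrK.
Qed.

End Shift.

Section Antidiag.
Context (R : realType) (H K : hilbertType R).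
Variables (A : set (hsum K H)) (B : set (hsum H K)).
Hypotheses (CRA : CR A) (CRB : CR B).
Hypotheses (domA : rel_dom A = setT) (domB : rel_dom B = setT).
Hypotheses (CRAB : CR (rel_comp A B)) (CRBA : CR (rel_comp B A)).
Local Notation HK := (hsum H K).
Local Notation T := (antidiag A B).
Local Notation AB l := (rel_shift (rel_comp A B) l).
Local Notation BA l := (rel_shift (rel_comp B A) l).

Lemma antidiag_CR : CR T.
Proof.
apply: CR_setI.
  exact: CR_preimage (@linear_fst _ H K) (@linear_snd _ H K)
    (@rnorm_fst _ H K) (@rnorm_snd _ H K) CRB.
exact: CR_preimage (@linear_snd _ H K) (@linear_fst _ H K)
  (@rnorm_snd _ H K) (@rnorm_fst _ H K) CRA.
Qed.

Lemma antidiag_dom : rel_dom T = setT.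
Proof.
apply/seteqP; split=> // x _.
have [y Bxy] : rel_dom B x.1 by rewrite domB.
have [z Axz] : rel_dom A x.2 by rewrite domA.
by exists ((z, y) : HK).
Qed.

(** [T - l] and [T + l] multiply to [T^2 - l^2], with
[T^2 = rel_dsum (rel_comp A B) (rel_comp B A)]. *)
Lemma antidiag_factor l : rel_comp (rel_shift T l) (rel_shift T (- l)) =
  rel_dsum (AB (l ^+ 2)) (BA (l ^+ 2)).
Proof.
have [subA _] := CRA; have [subB _] := CRB.
apply/seteqP; split=> -[x q].
  move=> [z /rel_shiftE[/= Bxz Axz] /rel_shiftE[/= Bzq Azq]].
  rewrite !scaleNr in Bxz Axz.
  split; apply/rel_shiftE => /=.
    exists (z.2 - l *: x.2) => //=.
    have := relB subA Azq (relZ subA l Axz).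
    by rewrite scalerBr scalerA -expr2 opprB addrA addrAC addrK.
  exists (z.1 - l *: x.1) => //=.
  have := relB subB Bzq (relZ subB l Bxz).
  by rewrite scalerBr scalerA -expr2 opprB addrA addrAC addrK.
move=> [/rel_shiftE[v /= Bxv Av] /rel_shiftE[u /= Axu Bu]].
exists ((u + l *: x.1, v + l *: x.2) : HK); apply/rel_shiftE.
  by split=> /=; rewrite scaleNr addrK.
split=> /=; rewrite scalerDr scalerA -expr2 [l *: _ + _]addrC addrA.
  exact: (relD subB Bu (relZ subB l Bxv)).
exact: (relD subA Av (relZ subA l Axu)).
Qed.

(** [antidiag A B] anticommutes with the symmetry [(x, y) |-> (x, -y)]. *)
Lemma antidiag_conj (l : R[i]) (x y : HK) :
  rel_shift T (- l) (x, y) <->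
  rel_shift T l (((x.1, - x.2) : HK), ((- y.1, y.2) : HK)).
Proof.
have [subA _] := CRA.
split=> /rel_shiftE[/= Bxy Axy]; apply/rel_shiftE; split=> /=.
- by rewrite scalerN -scaleNr.
- have := relZ subA (-1) Axy; rewrite !scaleN1r opprD.
  by rewrite scaleNr opprK.
- by rewrite scalerN -scaleNr in Bxy.
- have := relZ subA (-1) Axy; rewrite !scaleN1r opprD !opprK.
  by rewrite scaleNr.
Qed.

Lemma antidiag_conj_phi l :
  (phi_plus (rel_shift T l) -> phi_plus (rel_shift T (- l))) /\
  (phi_minus (rel_shift T l) -> phi_minus (rel_shift T (- l))).
Proof.
have CRT := rel_shift_CR (- l) antidiag_CR.
pose f (x : HK) : HK := (x.1, - x.2); pose g (y : HK) : HK := (- y.1, y.2).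
have linf : linear f.
  by move=> a x y; congr (_, _); rewrite /= opprD scalerN.
have ling : linear g.
  by move=> a x y; congr (_, _); rewrite /= opprD scalerN.
have fK : involutive f by move=> [x y]; rewrite /f /= opprK.
have gK : involutive g by move=> [x y]; rewrite /g /= opprK.
have gN y : rnorm (g y) = rnorm y by rewrite /rnorm !hsum_normE /= normrN.
split.
  exact: (phi_plus_conj linf fK ling gK gN (antidiag_conj l) CRT).
exact: (phi_minus_conj fK ling gK gN (antidiag_conj l) CRT).
Qed.

Lemma antidiag_phi_plus l : phi_plus (rel_shift T l) <->
  phi_plus (AB (l ^+ 2)) /\ phi_plus (BA (l ^+ 2)).
Proof.
have CRS k := rel_shift_CR k antidiag_CR.
have CRD : CR (rel_dsum (AB (l ^+ 2)) (BA (l ^+ 2))).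
  by apply: rel_dsum_CR; exact: rel_shift_CR.
have factorN : rel_comp (rel_shift T (- l)) (rel_shift T l) =
    rel_dsum (AB (l ^+ 2)) (BA (l ^+ 2)).
  by rewrite -{2}[l]opprK antidiag_factor sqrrN.
rewrite -(phi_plus_dsum (rel_shift_CR _ CRAB) (rel_shift_CR _ CRBA)).
split=> [phiT|phiD].
  rewrite -antidiag_factor in CRD *.
  by apply: phi_plus_comp => //; exact: (antidiag_conj_phi l).1.
apply: (@phi_plus_compr _ _ _ _ (rel_shift T (- l))) => //.
- exact: rel_shift_dom antidiag_dom.
- have [_ _] := phiD; rewrite -antidiag_factor; apply: finite_dim_sub.
    exact: rel_ker_subspace (CRS _).1.
  by move=> x Sx; exists 0 => //; exact: subspace0 (CRS l).1.
- by rewrite factorN.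
Qed.

Lemma antidiag_phi_minus l : phi_minus (rel_shift T l) <->
  phi_minus (AB (l ^+ 2)) /\ phi_minus (BA (l ^+ 2)).
Proof.
have CRS k := rel_shift_CR k antidiag_CR.
have CRD : CR (rel_dsum (AB (l ^+ 2)) (BA (l ^+ 2))).
  by apply: rel_dsum_CR; exact: rel_shift_CR.
rewrite -(phi_minus_dsum (rel_shift_CR _ CRAB) (rel_shift_CR _ CRBA)).
rewrite -antidiag_factor in CRD *.
split=> [phiT|]; last exact: phi_minus_compl.
by apply: phi_minus_comp => //; exact: (antidiag_conj_phi l).2.
Qed.

End Antidiag.

Theorem corollary4p7 (R : realType) (H K : hilbertType R)
    (A : set (hsum K H)) (B : set (hsum H K))
    (A_closed : CR A) (A_bounded : BCR A)
    (B_closed : CR B) (B_bounded : BCR B)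
    (AB_closed : CR (rel_comp A B)) (BA_closed : CR (rel_comp B A)) :
  let T := antidiag A B in
  let AB := rel_comp A B in
  let BA := rel_comp B A in
  sigma_e4 T = [set l | (sigma_e4 AB `|` sigma_e4 BA) (l ^+ 2)] /\
  sigma_e3 T = [set l | (sigma_e3 AB `|` sigma_e3 BA
                         `|` (sigma_e1 AB `&` sigma_e2 BA)
                         `|` (sigma_e2 AB `&` sigma_e1 BA)) (l ^+ 2)].
Proof.
have [_ _ domA] := A_bounded; have [_ _ domB] := B_bounded.
have plus := antidiag_phi_plus A_closed B_closed domA domB AB_closed BA_closed.
have minus := antidiag_phi_minus A_closed B_closed AB_closed BA_closed.
move=> T AB BA; split; apply/seteqP; split=> l;
  rewrite /sigma_e4 /sigma_e3 /sigma_e2 /sigma_e1 /= plus minus;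
  have [?|?] := pselect (phi_plus (rel_shift AB (l ^+ 2)));
  have [?|?] := pselect (phi_minus (rel_shift AB (l ^+ 2)));
  tauto.
Qed.
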